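(* The assignment $\mathcal{X}\mapsto\widehat{\mathcal{X}}$ extends to a functor $\mathbf{SSS}\to\mathbf{SSS}$ which is the identity on underlying sets and on maps, and: 1. $\widehat{\widehat{\mathcal{X}}}=\widehat{\mathcal{X}}$, and the identity map $\eta_{\mathcal{X}}:\mathcal{X}\to\widehat{\mathcal{X}}$ is a natural transformation $\mathrm{id}_{\mathbf{SSS}}\Rightarrow\widehat{(-)}$; 2. writing $\mathbf{SSS}_{\mathrm{pr}}$ for the full subcategory of the presented objects, i.e. those $\mathcal{X}$ with $\mathcal{X}=\widehat{\mathcal{X}}$, the functor $\widehat{(-)}$ is left adjoint to the inclusion $\mathbf{SSS}_{\mathrm{pr}}\subseteq\mathbf{SSS}$; that is, $\mathbf{SSS}_{\mathrm{pr}}$ is a reflective subcategory with reflector $\widehat{(-)}$ and unit $\eta$; 3. $\mathbf{SSS}_{\mathrm{pr}}$ contains $\mathbb{R}^k$ for every $k$, every manifold $M$, every rigid object $\flat\mathcal{S}$ and every loose object $\sharp\mathcal{S}$ ($\mathcal{S}$ a quasi-universal space), and is closed under products.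
   Context: **Sample space.** $\Omega=[0,1]^{\mathbb{N}}$; $\mathcal{B}_\Omega$ is the universal completion of its Borel (product) $\sigma$-algebra, i.e. all universally measurable subsets; $\Omega^\Omega$ is the set of all $\mathcal{B}_\Omega$-$\mathcal{B}_\Omega$-measurable self-maps of $\Omega$. **Site.** $\Omega_n:=\mathbb{R}^n\times\Omega$, $n\ge0$ ($\Omega_0=\Omega$). A map $g:\Omega_m\to\mathbb{R}^n$ is mixed-smooth, $g\in\mathcal{C}^\infty_{\mathrm{mix}}(\Omega_m,\mathbb{R}^n)$, if (M1) $g(-,\omega)\in C^\infty(\mathbb{R}^m,\mathbb{R}^n)$ for every $\omega$, and (M2) $g(t,-)$ is $\mathcal{B}_\Omega$-Borel measurable for every $t$. The category $\mathbb{S}$ has objects $\Omega_n$ and morphisms $\mathbb{S}(\Omega_m,\Omega_n)=\{(g,\Phi): g\in\mathcal{C}^\infty_{\mathrm{mix}}(\Omega_m,\mathbb{R}^n),\Phi\in\Omega^\Omega\}$, where $(g,\Phi)(t,\omega)=(g(t,\omega),\Phi(\omega))$. **Sample-smooth spaces.** A sample-smooth space is a set $\mathcal{X}$ with, for each $n\ge0$, a set $\mathcal{X}^{\Omega_n}$ of maps $\Omega_n\to\mathcal{X}$ (plots) containing all constant maps and such that $p\in\mathcal{X}^{\Omega_n}$, $h\in\mathbb{S}(\Omega_m,\Omega_n)$ imply $p\circ h\in\mathcal{X}^{\Omega_m}$. A map $f:\mathcal{X}\to\mathcal{Y}$ is sample-smooth (a morphism of $\mathbf{SSS}$) if $f\circ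 p\in\mathcal{Y}^{\Omega_n}$ for all $n$ and $p\in\mathcal{X}^{\Omega_n}$. Random variables: $\mathcal{X}^\Omega:=\mathcal{X}^{\Omega_0}$; $n$-parameter families: $\mathcal{X}^{\mathbb{R}^n}:=\{\gamma:\mathbb{R}^n\to\mathcal{X}:\gamma\circ\mathrm{pr}_{\mathbb{R}^n}\in\mathcal{X}^{\Omega_n}\}$. Products: $(\prod_i\mathcal{X}_i)^{\Omega_n}=\prod_i\mathcal{X}_i^{\Omega_n}$. **Maximal extension.** $\widehat{\mathcal{X}}$ is the set $\mathcal{X}$ with $$\widehat{\mathcal{X}}^{\Omega_n}:=\{p:\Omega_n\to\mathcal{X}\ :\ p(-,\omega)\in\mathcal{X}^{\mathbb{R}^n}\ \forall\omega\in\Omega,\ \text{ and }\ p\circ h\in\mathcal{X}^\Omega\ \forall h\in\mathbb{S}(\Omega_0,\Omega_n)\}.$$ Thus an object is presented exactly when its plots are those given by this formula in terms of its random variables and $n$-parameter families. **Examples.** $\mathbb{R}^k$ has plots $\mathcal{C}^\infty_{\mathrm{mix}}(\Omega_n,\mathbb{R}^k)$. A manifold $M$ (finite-dimensional, smooth, second-countable, Hausdorff) has as plots $p:\Omega_n\to M$ the maps with $p(-,\omega)\in C^\infty(\mathbb{R}^n,M)$ for all $\omega$ and $p(t,-)$ $\mathcal{B}_\Omega$-Borel measurable for all $t$. A quasi-universal space is a set $\mathcal{S}$ with a set $\mathcal{S}^\Omega$ of maps $\Omega\to\mathcal{S}$ containing constants and closed under precomposition with $\Omega^\Omega$; $\flat\mathcal{S}$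 is $\mathcal{S}$ with plots $\{(t,\omega)\mapsto X(\omega):X\in\mathcal{S}^\Omega\}$, and $\sharp\mathcal{S}$ is $\mathcal{S}$ with plots $\{p: p\circ h\in\mathcal{S}^\Omega\ \forall h\in\mathbb{S}(\Omega_0,\Omega_n)\}$. *)

(* Defs.v *)
From HB Require Import structures.
From mathcomp Require Import all_boot all_order all_algebra.
From mathcomp Require Import all_classical all_reals all_analysis.
From mathcomp Require Import measurable_realfun.

Set Implicit Arguments.
Unset Strict Implicit.
Unset Printing Implicit Defensive.

Import Order.TTheory GRing.Theory Num.Theory.
Import numFieldNormedType.Exports.

Local Open Scope classical_set_scope.
Local Open Scope ring_scope.

Record category := Category {
  obj :> Type ;
  hom : obj -> obj -> Type ;
  idm : forall X, hom X X ;
  cmp : forall X Y Z, hom Y Z -> hom X Y -> hom X Z ;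
  cmp1m : forall X Y (f : hom X Y), cmp (idm Y) f = f ;
  cmpm1 : forall X Y (f : hom X Y), cmp f (idm X) = f ;
  cmpA : forall X Y Z W (h : hom Z W) (g : hom Y Z) (f : hom X Y),
    cmp h (cmp g f) = cmp (cmp h g) f }.

Arguments hom {c} X Y.
Arguments idm {c} X.
Arguments cmp {c X Y Z} g f.

Record functor (C D : category) := Functor {
  fobj :> C -> D ;
  fmap : forall X Y, hom X Y -> hom (fobj X) (fobj Y) ;
  fmap_id : forall X, fmap (idm X) = idm (fobj X) ;
  fmap_cmp : forall X Y Z (g : hom Y Z) (f : hom X Y),
    fmap (cmp g f) = cmp (fmap g) (fmap f) }.

Arguments fmap {C D} _ {X Y}.

Definition id_functor (C : category) : functor C C :=
  {| fobj := fun X : C => X ; fmap := fun X Y (f : hom X Y) => f ;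
     fmap_id := fun X => erefl ; fmap_cmp := fun X Y Z g f => erefl |}.

Section comp_functor.
Variables (C D E : category) (G : functor D E) (F : functor C D).

Let map X Y (f : hom X Y) : hom (G (F X)) (G (F Y)) := fmap G (fmap F f).

Let map_id X : map (idm X) = idm (G (F X)).
Proof. by rewrite /map !fmap_id. Qed.

Let map_cmp X Y Z (g : hom Y Z) (f : hom X Y) :
  map (cmp g f) = cmp (map g) (map f).
Proof. by rewrite /map !fmap_cmp. Qed.

Definition comp_functor : functor C E :=
  {| fmap_id := map_id ; fmap_cmp := map_cmp |}.

End comp_functor.

Record nat_trans (C D : category) (F G : functor C D) := NatTrans {
  component :> forall X : C, hom (F X) (G X) ;
  naturality : forall (X Y : C) (f : hom X Y),
    cmp (component Y) (fmap F f) = cmp (fmap G f) (component X) }.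

Record adjunction (C D : category) (L : functor C D) (U : functor D C) :=
  Adjunction {
  unit : nat_trans (id_functor C) (comp_functor U L) ;
  counit : nat_trans (comp_functor L U) (id_functor D) ;
  triangleL : forall X : C, cmp (counit (L X)) (fmap L (unit X)) = idm (L X) ;
  triangleU : forall Y : D, cmp (fmap U (counit Y)) (unit (U Y)) = idm (U Y) }.

Definition full_subcategory (C : category) (P : C -> Prop) : category :=
  {| obj := {X : C | P X} ;
     hom := fun X Y => hom (sval X) (sval Y) ;
     idm := fun X => idm (sval X) ;
     cmp := fun X Y Z (g : hom (sval Y) (sval Z)) f => cmp g f ;
     cmp1m := fun X Y f => cmp1m f ;
     cmpm1 := fun X Y f => cmpm1 f ;
     cmpA := fun X Y Z W h g f => cmpA h g f |}.

Definition inclusion (C : category) (P : C -> Prop) :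
    functor (full_subcategory P) C :=
  {| fobj := fun X : full_subcategory P => sval X ;
     fmap := fun (X Y : full_subcategory P) (f : hom X Y) => f ;
     fmap_id := fun X => erefl ; fmap_cmp := fun X Y Z g f => erefl |}.

Definition corestriction (C D : category) (P : D -> Prop) (F : functor C D)
    (FP : forall X, P (F X)) : functor C (full_subcategory P) :=
  {| fobj := fun X => exist P (F X) (FP X) : full_subcategory P ;
     fmap := fun X Y (f : hom X Y) => fmap F f ;
     fmap_id := fun X => fmap_id F X ;
     fmap_cmp := fun X Y Z g f => fmap_cmp F g f |}.

Arguments corestriction {C D} P F FP.
Arguments inclusion {C} P.

Definition Omega (R : realType) := nat -> {i01 R}.

HB.instance Definition _ (R : realType) := gen_eqMixin (Omega R).
HB.instance Definition _ (R : realType) := gen_choiceMixin (Omega R).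
HB.instance Definition _ (R : realType) :=
  isPointed.Build (Omega R) (fun=> 0%:i01).

Definition cylinder (R : realType) : set (set (Omega R)) :=
  [set A | exists (n : nat) (B : set R),
     measurable B /\ A = [set w | B (w n)%:num]].

Definition Omega_borel (R : realType) : Type :=
  g_sigma_algebraType (@cylinder R).

HB.instance Definition _ (R : realType) :=
  Measurable.on (Omega_borel R).

Definition universally_measurable (R : realType) : set (set (Omega R)) :=
  [set A | forall P : probability (Omega_borel R) R,
     completed_algebra_gen P A].

Section universally_measurable_sigma_algebra.
Variable R : realType.

Lemma universally_measurable0 : @universally_measurable R set0.
Proof.
move=> P; exists set0; first exact: measurable0.
by exists set0; [exact: negligible_set0|rewrite setU0].
Qed.

Lemma universally_measurableC (A : set (Omega R)) :
  universally_measurable A -> universally_measurable (~` A).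
Proof.
move=> mA P; have [B mB [N [Z [mZ PZ NZ]] <-]] := mA P.
exists (~` (B `|` Z)); first exact/measurableC/measurableU.
exists (Z `\` (B `|` N)).
  by exists Z; split => //; exact: subDsetl.
apply/seteqP; split => x /=.
- by case=> [nBZ [Bx|Nx]|[_ //]]; apply: nBZ; [left|right; exact: NZ].
- move=> nBN; have [Zx|nZx] := pselect (Z x); first by right.
  by left => -[Bx|//]; apply: nBN; left.
Qed.

Lemma universally_measurable_bigcup (F : (set (Omega R))^nat) :
  (forall i, universally_measurable (F i)) ->
  universally_measurable (\bigcup_i F i).
Proof.
move=> mF P.
have /choice[BN BNP] : forall i, exists BN : set (Omega R) * set (Omega R),
    [/\ (measurable : set (set (Omega_borel R))) BN.1,
        P.-negligible BN.2 & BN.1 `|` BN.2 = F i].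
  by move=> i; have [B mB [N nN <-]] := mF i P; exists (B, N).
exists (\bigcup_i (BN i).1).
  by apply: bigcup_measurable => i _; have [] := BNP i.
exists (\bigcup_i (BN i).2).
  by apply: negligible_bigcup => i; have [] := BNP i.
by rewrite -bigcupU; apply: eq_bigcupr => i _; have [] := BNP i.
Qed.

End universally_measurable_sigma_algebra.

Fact Omega_display : measure_display. Proof. exact: default_measure_display. Qed.

HB.instance Definition _ (R : realType) :=
  isMeasurable.Build Omega_display (Omega R)
    (@universally_measurable0 R) (@universally_measurableC R)
    (@universally_measurable_bigcup R).

(* [T] need not be inhabited, whence no [measurableType] structure on it. *)
Definition borel_measurable (R : realType) (T : topologicalType)
    (f : Omega R -> T) :=
  forall B : set T, <<s @open T >> B -> measurable (f @^-1` B).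

Section smooth.
Variables (R : realType) (m n : nat).
Implicit Types (U : set 'rV[R]_m) (f : 'rV[R]_m -> 'rV[R]_n).

(* All partial derivatives of order at most [k] exist and are continuous on
   the open set [U]. *)
Fixpoint Ck_on (k : nat) U f : Prop :=
  (forall x, U x -> {for x, continuous f}) /\
  if k is k'.+1 then
    forall i : 'I_m, (forall x, U x -> derivable f x (delta_mx 0 i)) /\
      Ck_on k' U (fun x => 'D_(delta_mx 0 i) f x)
  else True.

Definition smooth_on U f := forall k, Ck_on k U f.

Definition smooth f := smooth_on setT f.

End smooth.

Definition OmegaN (R : realType) (n : nat) : Type := 'rV[R]_n * Omega R.

Definition mixed_smooth (R : realType) (m n : nat)
    (g : OmegaN R m -> 'rV[R]_n) :=
  (forall w, smooth (fun t => g (t, w))) /\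
  (forall t, borel_measurable (fun w => g (t, w))).

Definition site_hom (R : realType) (m n : nat) :
    set (OmegaN R m -> OmegaN R n) :=
  [set h | exists (g : OmegaN R m -> 'rV[R]_n) (Phi : Omega R -> Omega R),
     [/\ mixed_smooth g, measurable_fun setT Phi &
         h = (fun x => (g x, Phi x.2))]].

Definition plot_family (R : realType) (T : Type) :=
  forall n : nat, set (OmegaN R n -> T).

Definition is_sample_smooth_space (R : realType) (T : Type)
    (P : plot_family R T) :=
  (forall n (x : T), P n (fun=> x)) /\
  (forall m n (p : OmegaN R n -> T) (h : OmegaN R m -> OmegaN R n),
     P n p -> site_hom h -> P m (p \o h)).

Record SSS (R : realType) := MkSSS {
  carrier :> Type ;
  plots : plot_family R carrier ;
  sssP : is_sample_smooth_space plots }.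

Definition sample_smooth (R : realType) (S T : Type)
    (P : plot_family R S) (Q : plot_family R T) (f : S -> T) :=
  forall n (p : OmegaN R n -> S), P n p -> Q n (f \o p).

Arguments plots {R} s.

Record sss_hom (R : realType) (X Y : SSS R) := SSSHom {
  sss_fun :> X -> Y ;
  sss_funP : sample_smooth (plots X) (plots Y) sss_fun }.

Lemma sss_hom_eq (R : realType) (X Y : SSS R) (f g : sss_hom X Y) :
  sss_fun f = sss_fun g -> f = g.
Proof.
case: f g => [f fP] [g gP] /= fg; rewrite fg in fP *.
by congr SSSHom; exact: Prop_irrelevance.
Qed.

Definition sss_id (R : realType) (X : SSS R) : sss_hom X X :=
  @SSSHom R X X (fun x => x) (fun n p Pp => Pp).

Definition sss_cmp (R : realType) (X Y Z : SSS R)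
    (g : sss_hom Y Z) (f : sss_hom X Y) : sss_hom X Z :=
  @SSSHom R X Z (fun x => g (f x))
    (fun n p Pp => sss_funP g (sss_funP f Pp)).

Canonical SSS_cat (R : realType) : category :=
  {| obj := SSS R ; hom := @sss_hom R ; idm := @sss_id R ;
     cmp := @sss_cmp R ;
     cmp1m := fun X Y f => @sss_hom_eq R X Y (sss_cmp (sss_id Y) f) f erefl ;
     cmpm1 := fun X Y f => @sss_hom_eq R X Y (sss_cmp f (sss_id X)) f erefl ;
     cmpA := fun X Y Z W h g f => erefl |}.

Definition random_variable (R : realType) (T : Type) (P : plot_family R T) :
    set (OmegaN R 0 -> T) := P 0%N.

Definition param_family (R : realType) (T : Type) (P : plot_family R T)
    (n : nat) : set ('rV[R]_n -> T) :=
  [set c | P n (fun x => c x.1)].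

Definition prod_plots (R : realType) (I : Type) (T : I -> Type)
    (P : forall i, plot_family R (T i)) : plot_family R (forall i, T i) :=
  fun n => [set p | forall i, P i n (fun x => p x i)].

Definition hat_plots (R : realType) (T : Type) (P : plot_family R T) :
    plot_family R T :=
  fun n => [set p |
    (forall w : Omega R, param_family P (fun t => p (t, w))) /\
    (forall h : OmegaN R 0 -> OmegaN R n,
       site_hom h -> random_variable P (p \o h))].

Definition presented (R : realType) (X : SSS R) : Prop :=
  plots X = hat_plots (plots X).

Definition hat_space (R : realType)
    (hat_obj : forall X : SSS R,
       is_sample_smooth_space (hat_plots (plots X))) (X : SSS R) : SSS R :=
  MkSSS (hat_obj X).

(* [hat_plots] on objects and the identity on underlying maps, given that these
   assignments are well defined. *)
Definition hat_functor (R : realType)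
    (hat_obj : forall X : SSS R,
       is_sample_smooth_space (hat_plots (plots X)))
    (hat_hom : forall (X Y : SSS R) (f : X -> Y),
       sample_smooth (plots X) (plots Y) f ->
       sample_smooth (hat_plots (plots X)) (hat_plots (plots Y)) f) :
    functor (SSS_cat R) (SSS_cat R) :=
  let hat := hat_space hat_obj in
  let hat_map X Y (f : sss_hom X Y) : sss_hom (hat X) (hat Y) :=
    @SSSHom R (hat X) (hat Y) (sss_fun f) (hat_hom X Y f (sss_funP f)) in
  @Functor (SSS_cat R) (SSS_cat R) hat hat_map
    (fun X => @sss_hom_eq R (hat X) (hat X)
       (hat_map X X (sss_id X)) (sss_id (hat X)) erefl)
    (fun X Y Z g f => @sss_hom_eq R (hat X) (hat Z)
       (hat_map X Z (sss_cmp g f))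
       (sss_cmp (hat_map Y Z g) (hat_map X Y f)) erefl).

(* The set [T] with plots [P] is an object of the full subcategory of the
   presented objects. *)
Definition is_presented_space (R : realType) (T : Type)
    (P : plot_family R T) : Prop :=
  exists H : is_sample_smooth_space P, presented (MkSSS H).

Definition euclidean_plots (R : realType) (k : nat) :
    plot_family R 'rV[R]_k := fun n => [set p | mixed_smooth p].

(* [chart_inv] is only meaningful on the image of the chart. *)
Record chart (R : realType) (M : topologicalType) (d : nat) := Chart {
  chart_dom : set M ;
  chart_map : M -> 'rV[R]_d ;
  chart_inv : 'rV[R]_d -> M ;
  chart_dom_open : open chart_dom ;
  chart_img_open : open (chart_map @` chart_dom) ;
  chart_mapK : {in chart_dom, cancel chart_map chart_inv} ;
  chart_map_continuous : {within chart_dom, continuous chart_map} ;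
  chart_inv_continuous :
    {within chart_map @` chart_dom, continuous chart_inv} }.

Record manifold (R : realType) := Manifold {
  mf_carrier :> topologicalType ;
  mf_dim : nat ;
  mf_hausdorff : hausdorff_space mf_carrier ;
  mf_second_countable : @second_countable mf_carrier ;
  mf_atlas : set (chart R mf_carrier mf_dim) ;
  mf_atlas_cover : forall x : mf_carrier,
    exists2 c, mf_atlas c & chart_dom c x ;
  mf_atlas_compatible : forall c c', mf_atlas c -> mf_atlas c' ->
    smooth_on (chart_map c @` (chart_dom c `&` chart_dom c'))
      (chart_map c' \o chart_inv c) }.

Arguments mf_atlas {R} m.

Definition smooth_into (R : realType) (n : nat) (M : manifold R)
    (c : 'rV[R]_n -> M) :=
  continuous c /\
  forall phi, mf_atlas M phi ->
    smooth_on (c @^-1` chart_dom phi) (chart_map phi \o c).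

Definition manifold_plots (R : realType) (M : manifold R) : plot_family R M :=
  fun n => [set p |
    (forall w, smooth_into (fun t => p (t, w))) /\
    (forall t, borel_measurable (fun w => p (t, w)))].

Record quasi_universal_space (R : realType) := QUS {
  qus_carrier :> Type ;
  qus_rv : set (Omega R -> qus_carrier) ;
  qus_rv_const : forall x : qus_carrier, qus_rv (fun=> x) ;
  qus_rv_comp : forall (X : Omega R -> qus_carrier) (Phi : Omega R -> Omega R),
    qus_rv X -> measurable_fun setT Phi -> qus_rv (X \o Phi) }.

Arguments qus_rv {R} q.

Definition flat_plots (R : realType) (S : quasi_universal_space R) :
    plot_family R S :=
  fun n => [set p | exists2 X, qus_rv S X & p = (fun x => X x.2)].

(* [fun w => h (0, w)] is [h] under the identification of [OmegaN R 0] with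
   [Omega R]. *)
Definition sharp_plots (R : realType) (S : quasi_universal_space R) :
    plot_family R S :=
  fun n => [set p | forall h : OmegaN R 0 -> OmegaN R n,
    site_hom h -> qus_rv S (fun w => p (h (0, w)))].

Arguments euclidean_plots R k n : clear implicits.
Arguments manifold_plots {R} M n.
Arguments flat_plots {R} S n.
Arguments sharp_plots {R} S n.

(* Main.v *)
Require Import Defs.
From HB Require Import structures.
From mathcomp Require Import all_boot all_order all_algebra.
From mathcomp Require Import all_classical all_reals all_analysis.

Set Implicit Arguments.
Unset Strict Implicit.
Unset Printing Implicit Defensive.

Import Order.TTheory GRing.Theory Num.Theory.
Import numFieldNormedType.Exports.

Local Open Scope classical_set_scope.
Local Open Scope ring_scope.

(** Everything about [hat_plots] is formal once one knows two facts on the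
    site: its morphisms are closed under composition, and they include the
    sections [w |-> (t, w)], the maps [(t, w') |-> (t, w)] freezing the sample,
    and the reparametrizations [(t, w) |-> (g t, w)] with [g] smooth.  Freezing
    the sample and composing shows that plots are plots of the maximal
    extension; for a morphism [h = (g, Phi)] the slice of [p \o h] at [w] is the
    slice of [p] at [Phi w] reparametrized by [g (-, w)], so the extension is
    again a space.  It has the same random variables and the same parameter
    families as the original space, hence is idempotent; and all the functors
    and transformations in sight are the identity on underlying maps, so that
    naturality and the triangle identities hold on the nose: the counit at a
    presented space is the identity map, which is a morphism exactly because
    the space is presented.

    The analytic content is the composition of site morphisms and its analogue
    for manifolds: if [p] is smooth in [t] and measurable in [w], so is
    [(t, w) |-> p (g (t, w), Phi w)].

    Smoothness in [t] is the chain rule.  Smoothness being phrased by iterated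
    partial derivatives, one first shows that a map with continuous partial
    derivatives is differentiable ([partials_differentiable]), moving along one
    coordinate at a time and using the mean value theorem; the chain rule then
    expresses the partial derivatives of a composite by sums of products of
    maps of one order less, and [Ck_on_comp] follows by induction on the order.

    Measurability in [w] of [w |-> p (G w, Phi w)] is Caratheodory's argument
    ([caratheodory_comp]): [G] is the limit of maps [G_k] with countably many
    values, for which the claim holds piece by piece, and continuity of [p] in
    [t] passes to the limit.  A pointwise limit of measurable maps is measurable
    as soon as each open set of the target is a countable union of open sets
    whose closures it contains ([borel_measurable_lim]).  This holds in metric
    spaces, and in regular second countable ones; a manifold is regular because
    its points have compact neighborhoods, given by closed balls in charts.

    Euclidean spaces and manifolds are then treated together
    ([fiberwise_plots_presented]): their plots are defined by a condition on
    each slice [p (-, w)] and a measurability condition on each [p (t, -)], and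
    the latter is about the random variables [w |-> p (t, w)] only. *)

(** * Continuous partial derivatives imply differentiability *)

Section differentiability.
Variables (R : realType).

Lemma near_eq_continuous (T U : topologicalType) (f g : T -> U) (x : T) :
  {near x, f =1 g} -> {for x, continuous f} -> {for x, continuous g}.
Proof.
move=> fg fx; rewrite /prop_for /continuous_at -(nbhs_singleton fg).
by apply: cvg_trans fx; exact: near_eq_cvg.
Qed.

Lemma is_derive_line (V W : normedModType R) (f : V -> W) (y v : V) (s : R) :
  derivable f (s *: v + y) v ->
  is_derive s 1 (fun r => f (r *: v + y)) ('D_v f (s *: v + y)).
Proof.
suff E : (fun h : R => h^-1 *:
    (((fun r => f (r *: v + y)) \o shift s) (h *: 1) - f (s *: v + y))) =
  (fun h : R => h^-1 *: ((f \o shift (s *: v + y)) (h *: v) - f (s *: v + y))).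
  by move=> df; split; [rewrite /derivable E|rewrite /derive E].
by apply/funext => h /=; rewrite [_%:A]mulr1 scalerDl addrA.
Qed.

(** The sign of [a] is arbitrary, whence the bound by absolute values in place
    of an interval. *)
Lemma mean_value_along (V : normedModType R) (f : V -> R) (y v : V) (a : R) :
  (forall s : R, `|s| <= `|a| -> derivable f (s *: v + y) v) ->
  exists2 s : R, `|s| <= `|a| &
    f (a *: v + y) - f y = a * 'D_v f (s *: v + y).
Proof.
move=> df; pose psi (r : R) := f (r *: v + y).
have psi0 : psi 0 = f y by rewrite /psi scale0r add0r.
have dpsi (s : R) : `|s| <= `|a| -> is_derive s 1 psi ('D_v f (s *: v + y)).
  by move=> sa; exact/is_derive_line/df.
have [a0|a0] := leP 0 a.
- have ia (s : R) : s \in `[0, a] -> `|s| <= `|a|.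
    by rewrite in_itv/= => /andP[s0 sa]; rewrite !ger0_norm.
  have [|||c cI E] := @MVT_segment R psi (fun s => 'D_v f (s *: v + y)) 0 a.
  + by [].
  + by move=> s sI; apply/dpsi/ia; exact: subset_itv_oo_cc.
  + by apply: derivable_within_continuous => s /ia /dpsi [].
  exists c; first exact: ia.
  by rewrite -psi0 -[f _]/(psi a) E subr0 mulrC.
- have ia (s : R) : s \in `[a, 0] -> `|s| <= `|a|.
    by rewrite in_itv/= => /andP[s0 sa]; rewrite !ler0_norm ?lerN2// ltW.
  have [|||c cI E] := @MVT_segment R psi (fun s => 'D_v f (s *: v + y)) a 0.
  + exact: ltW.
  + by move=> s sI; apply/dpsi/ia; exact: subset_itv_oo_cc.
  + by apply: derivable_within_continuous => s /ia /dpsi [].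
  exists c; first exact: ia.
  by rewrite -psi0 -[f _]/(psi a) -[LHS]opprB E sub0r mulrN opprK mulrC.
Qed.

Lemma coord_le_norm m (h : 'rV[R]_m) i : `|h 0 i| <= `|h|.
Proof. by rewrite [leRHS]/Num.Def.normr/= mx_normrE (le_bigmax _ _ (0, i)). Qed.

Lemma norm_le_coord m (h : 'rV[R]_m) (e : R) : 0 <= e ->
  (forall i, `|h 0 i| <= e) -> `|h| <= e.
Proof.
move=> e0 he; rewrite [leLHS]/Num.Def.normr/= mx_normrE.
by apply: bigmax_le => // -[i j] _; rewrite (ord1 i).
Qed.

(** The differential is a choice among linear maps, so its existence has to go
    through [diff_unique]; this form only asks for one linear approximation. *)
Lemma linear_approx_differentiable (V W : normedModType R) (f : V -> W)
    (L : {linear V -> W}) (x : V) : continuous L ->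
  (forall e : R, 0 < e ->
    \forall h \near 0, `|f (h + x) - (f x + L h)| <= e * `|h|) ->
  differentiable f x.
Proof.
move=> Lc fL; suff H : f \o shift x = cst (f x) + L +o_ 0 id.
  by apply/diff_locallyP; rewrite (diff_unique Lc H).
by apply/eqaddoP => e /fL.
Qed.

(** The increment [f (h + x) - f x] telescopes along the truncations of [h] to
    its first coordinates.  Each step moves along one axis, so the mean value
    theorem replaces it by a partial derivative taken near [x], which by
    continuity is close to the one at [x]. *)
Lemma partials_differentiable_scalar m (f : 'rV[R]_m -> R) (x : 'rV[R]_m) :
  (forall i, \forall y \near x, derivable f y (delta_mx 0 i)) ->
  (forall i, {for x, continuous (fun y => 'D_(delta_mx 0 i) f y)}) ->
  differentiable f x.
Proof.
move=> fd fc; pose D i y := 'D_(delta_mx 0 i) f y.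
pose L (h : 'rV[R]_m) := \sum_i h 0 i * D i x.
have L_lin : linear L.
  move=> a u v; rewrite /L scaler_sumr -big_split; apply: eq_bigr => i _ /=.
  by rewrite !mxE mulrDl scalerAl.
pose dL : {linear 'rV[R]_m -> R} :=
  HB.pack L (GRing.isLinear.Build _ _ _ _ _ L_lin).
have term_cont i : continuous (fun h : 'rV[R]_m => h 0 i * D i x : R).
  by move=> h; apply: cvgMr_tmp; [exact: nbhs_filter|exact: coord_continuous].
have L_cont : continuous dL.
  apply: continuous_big => [|i _]; first exact: add_continuous.
  exact: term_cont.
apply: (@linear_approx_differentiable _ _ f dL) => // e e0.
(* [m.+1] rather than [m], which may be zero *)
have e'0 : 0 < e / m.+1%:R by rewrite divr_gt0.
have /nbhs_normP[d /= d0 H] : \forall y \near x, forall i,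
    derivable f y (delta_mx 0 i) /\ `|D i x - D i y| <= e / m.+1%:R.
  apply: (@filter_forall _ _ _ (nbhs x) (nbhs_filter x)) => i.
  near=> y; split; first by near: y; exact: fd.
  by near: y; apply: (iffLR (cvgrPdist_le _ _) (fc i)).
apply/nbhs_normP; exists d => // h /=; rewrite sub0r normrN => hd.
(* [t k] keeps the coordinates of [h] of index less than [k] *)
pose t k : 'rV[R]_m := \row_i (if (i < k)%N then h 0 i else 0).
have t0 : t 0%N = 0 by apply/rowP => i; rewrite !mxE.
have tm : t m = h by apply/rowP => i; rewrite !mxE ltn_ord.
have tS (i : 'I_m) : t i.+1 = h 0 i *: delta_mx 0 i + t i.
  apply/rowP => j; rewrite !mxE eqxx/= ltnS leq_eqVlt.
  have [->|ji] := eqVneq j i; first by rewrite eqxx/= ltnn mulr1 addr0.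
  by rewrite (inj_eq val_inj) (negbTE ji)/= mulr0 add0r.
have step (i : 'I_m) :
    `|f (t i.+1 + x) - f (t i + x) - h 0 i * D i x| <= e / m.+1%:R * `|h|.
  have near_x (s : R) : `|s| <= `|h 0 i| ->
      `|x - (s *: delta_mx 0 i + (t i + x))| < d.
    move=> sh; apply: le_lt_trans hd.
    rewrite addrA opprD addrCA subrr addr0 normrN.
    apply: norm_le_coord => // j; rewrite !mxE eqxx/=.
    have [->|ji] := eqVneq j i.
      by rewrite ltnn mulr1 addr0 (le_trans sh)// coord_le_norm.
    by rewrite mulr0 add0r; case: ifP; rewrite ?normr0// coord_le_norm.
  have [s sh E] : exists2 s : R, `|s| <= `|h 0 i| &
      f (h 0 i *: delta_mx 0 i + (t i + x)) - f (t i + x) =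
      h 0 i * D i (s *: delta_mx 0 i + (t i + x)).
    by apply: mean_value_along => s /near_x /H /(_ i) [].
  rewrite tS -[in f (_ + _ + _)]addrA E -mulrBr normrM mulrC.
  apply: ler_pM => //; last exact: coord_le_norm.
  by rewrite distrC; have [] := H _ (near_x _ sh) i.
have -> : f (h + x) - (f x + dL h) =
    \sum_(i < m) (f (t i.+1 + x) - f (t i + x) - h 0 i * D i x).
  rewrite sumrB -(big_mkord predT (fun i => f (t i.+1 + x) - f (t i + x))).
  rewrite (telescope_sumr (fun k => f (t k + x)))// t0 tm add0r.
  by rewrite opprD addrA.
apply: le_trans (ler_norm_sum _ _ _) _.
apply: le_trans (ler_sum _ (fun i _ => step i)) _.
rewrite sumr_const card_ord -[leLHS]mulr_natl mulrA ler_wpM2r//.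
by rewrite mulrCA ger_pMr// ler_pdivrMr// mul1r ler_nat.
Unshelve. all: by end_near. Qed.

Lemma row_sum_coord (T : Type) n (f : T -> 'rV[R]_n) :
  f = fun x => \sum_(j < n) f x 0 j *: delta_mx 0 j.
Proof. by apply/funext => x; rewrite [LHS]row_sum_delta. Qed.

(** There is no mean value theorem for vector-valued maps, so one argues
    coordinate by coordinate. *)
Lemma partials_differentiable m n (f : 'rV[R]_m -> 'rV[R]_n) x :
  (forall i, \forall y \near x, derivable f y (delta_mx 0 i)) ->
  (forall i, {for x, continuous (fun y => 'D_(delta_mx 0 i) f y)}) ->
  differentiable f x.
Proof.
move=> fd fc.
have -> : f = \sum_(j < n) (fun y => f y 0 j *: (delta_mx 0 j : 'rV[R]_n)).
  by rewrite [LHS]row_sum_coord; apply/funext => y; rewrite fct_sumE.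
apply: differentiable_sum => j; apply: differentiableZl.
apply: partials_differentiable_scalar => i.
  near=> y; apply: (iffLR (derivable_mxP f y (delta_mx 0 i)) _ 0 j).
  by near: y; exact: fd.
have E : {near x, (fun y => 'D_(delta_mx 0 i) f y 0 j) =1
    (fun y => 'D_(delta_mx 0 i) (fun z => f z 0 j) y)}.
  by near=> y; rewrite derive_mx ?mxE//; near: y; exact: fd.
apply: near_eq_continuous E _.
apply: (@continuous_comp _ _ _ (fun y => 'D_(delta_mx 0 i) f y)
  (fun M : 'rV[R]_n => M 0 j)); [exact: fc|exact: coord_continuous].
Unshelve. all: by end_near. Qed.

End differentiability.

(** * Composition of maps of class C^k *)

Section Ck_calculus.
Variables (R : realType) (m : nat).
Implicit Types (U : set 'rV[R]_m).

Lemma Ck_onW n k U (f : 'rV[R]_m -> 'rV[R]_n) :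
  Ck_on k.+1 U f -> Ck_on k U f.
Proof.
elim: k f => [|k IH] f [fc df]; split => // i.
by have [dfi Dfi] := df i; split => //; exact: IH.
Qed.

Lemma Ck_on_le n j k U (f : 'rV[R]_m -> 'rV[R]_n) : (j <= k)%N ->
  Ck_on k U f -> Ck_on j U f.
Proof.
move=> jk; rewrite -(subnK jk); elim: (k - j)%N => // i IH /Ck_onW.
exact: IH.
Qed.

Lemma Ck_on_subset n k (U V : set 'rV[R]_m) (f : 'rV[R]_m -> 'rV[R]_n) :
  V `<=` U -> Ck_on k U f -> Ck_on k V f.
Proof.
move=> VU; elim: k f => [|k IH] f [fc df];
  (split; first by move=> x /VU; exact: fc).
  exact: I.
by move=> i; have [dfi Dfi] := df i; split=> [x /VU|]; [exact: dfi|exact: IH].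
Qed.

(** Openness is essential: derivatives at a point of [U] see the values of the
    map around that point. *)
Lemma Ck_on_eq n k U (f g : 'rV[R]_m -> 'rV[R]_n) : open U ->
  (forall x, U x -> f x = g x) -> Ck_on k U f -> Ck_on k U g.
Proof.
move=> oU; elim: k f g => [|k IH] f g fg [fc df].
  split; last exact: I.
  move=> x Ux; apply: near_eq_continuous (fc _ Ux).
  by apply: filterS (open_nbhs_nbhs (conj oU Ux)) => y /fg.
have fg_near x : U x -> {near x, f =1 g}.
  by move=> Ux; apply: filterS (open_nbhs_nbhs (conj oU Ux)) => y /fg.
split=> [x Ux|i]; first exact: near_eq_continuous (fg_near x Ux) (fc _ Ux).
have [dfi Dfi] := df i; split=> [x Ux|].
  exact: near_eq_derivable (fg_near x Ux) (dfi x Ux).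
apply: IH Dfi => x Ux; apply: near_eq_derive; exact: fg_near.
Qed.

Lemma Ck_on_cst n k U (c : 'rV[R]_n) : Ck_on k U (fun=> c).
Proof.
elim: k c => [|k IH] c; (split; first by move=> x _; exact: cst_continuous).
  exact: I.
move=> i; split=> [x _|]; first exact: derivable_cst.
have -> : (fun x : 'rV[R]_m => 'D_(delta_mx 0 i) (fun=> c) x) = fun=> 0.
  by apply/funext => x; rewrite derive_cst.
exact: IH.
Qed.

Lemma Ck_on_id k U : Ck_on k U (id : 'rV[R]_m -> 'rV[R]_m).
Proof.
have idc x : {for x, continuous (id : 'rV[R]_m -> 'rV[R]_m)} by exact: cvg_id.
case: k => [|k]; (split; first by move=> x _; exact: idc); first exact: I.
move=> i; split=> [x _|]; first exact: derivable_id.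
have -> : (fun x : 'rV[R]_m => 'D_(delta_mx 0 i) id x) = fun=> delta_mx 0 i.
  by apply/funext => x; rewrite derive_id.
exact: Ck_on_cst.
Qed.

Lemma Ck_on_add n k U (f g : 'rV[R]_m -> 'rV[R]_n) : open U ->
  Ck_on k U f -> Ck_on k U g -> Ck_on k U (f + g).
Proof.
move=> oU; elim: k f g => [|k IH] f g [fc df] [gc dg].
  split; last exact: I.
  by move=> x Ux; apply: continuousD; [exact: fc|exact: gc].
split=> [x Ux|i]; first by apply: continuousD; [exact: fc|exact: gc].
have [dfi Dfi] := df i; have [dgi Dgi] := dg i.
split=> [x Ux|]; first exact: derivableD (dfi x Ux) (dgi x Ux).
apply: Ck_on_eq (IH _ _ Dfi Dgi) => // x Ux.
by rewrite deriveD; [|exact: dfi|exact: dgi].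
Qed.

Lemma Ck_on_sum n k U (I : Type) (r : seq I)
    (f : I -> 'rV[R]_m -> 'rV[R]_n) : open U ->
  (forall i, Ck_on k U (f i)) -> Ck_on k U (fun x => \sum_(i <- r) f i x).
Proof.
move=> oU fi; rewrite -fct_sumE; elim/big_rec : _ => [|i g _ Cg].
  exact: Ck_on_cst.
exact: Ck_on_add.
Qed.

(** Scalar functions enter as coordinates of row-valued maps, so that the
    product stays inside the class of maps on which [Ck_on] is defined; these
    are the terms that the chain rule produces. *)
Lemma is_derive_coord_scale n p (a : 'rV[R]_m -> 'rV[R]_p)
    (b : 'rV[R]_m -> 'rV[R]_n) j (x v : 'rV[R]_m) :
  derivable a x v -> derivable b x v ->
  is_derive x v (fun y => a y 0 j *: b y)
    (('D_v a x) 0 j *: b x + a x 0 j *: 'D_v b x).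
Proof.
move=> da db.
have daj : derivable (fun y => a y 0 j) x v.
  exact: (iffLR (derivable_mxP a x v) da).
have dbl i l : derivable (fun y => b y i l) x v.
  exact: (iffLR (derivable_mxP b x v) db).
have dab : derivable (fun y => a y 0 j *: b y) x v.
  apply/derivable_mxP => i l.
  rewrite (_ : (fun _ => _) = (fun y => a y 0 j) * (fun y => b y i l)).
    exact: (derivableM daj (dbl i l)).
  by apply/funext => y; rewrite mxE.
split=> //; rewrite derive_mx//; apply/matrixP => i l; rewrite mxE.
rewrite (_ : (fun _ => _) = (fun y => a y 0 j) * (fun y => b y i l));
  last first.
  by apply/funext => y; rewrite mxE.
rewrite (deriveM daj (dbl i l)) (derive_mx da) (derive_mx db) !mxE addrC.
by congr (_ + _); exact: mulrC.
Qed.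

Lemma Ck_on_coord_scale n p k U (a : 'rV[R]_m -> 'rV[R]_p)
    (b : 'rV[R]_m -> 'rV[R]_n) j : open U ->
  Ck_on k U a -> Ck_on k U b -> Ck_on k U (fun x => a x 0 j *: b x).
Proof.
move=> oU.
have cont (a' : 'rV[R]_m -> 'rV[R]_p) (b' : 'rV[R]_m -> 'rV[R]_n) x :
    {for x, continuous a'} -> {for x, continuous b'} ->
    {for x, continuous (fun y => a' y 0 j *: b' y)}.
  move=> ac bc; apply: (@continuousZ _ _ _ (fun y => a' y 0 j) b') => //.
  apply: (@continuous_comp _ _ _ a' (fun M : 'rV[R]_p => M 0 j)) => //.
  exact: coord_continuous.
elim: k a b => [|k IH] a b Ca Cb.
  split; last exact: I.
  by move=> x Ux; apply: cont; [exact: Ca.1|exact: Cb.1].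
split=> [x Ux|i]; first by apply: cont; [exact: Ca.1|exact: Cb.1].
have [dai Dai] := Ca.2 i; have [dbi Dbi] := Cb.2 i.
split=> [x Ux|].
  by have [] := is_derive_coord_scale j (dai x Ux) (dbi x Ux).
apply: (@Ck_on_eq _ _ _ ((fun x => ('D_(delta_mx 0 i) a x) 0 j *: b x) +
    (fun x => a x 0 j *: 'D_(delta_mx 0 i) b x))) => //.
  move=> x Ux.
  by have [_ ->] := is_derive_coord_scale j (dai x Ux) (dbi x Ux).
apply: Ck_on_add => //; apply: IH => //; exact: Ck_onW.
Qed.

Lemma C1_on_differentiable n U (f : 'rV[R]_m -> 'rV[R]_n) x : open U ->
  Ck_on 1 U f -> U x -> differentiable f x.
Proof.
move=> oU [_ df] Ux; apply: partials_differentiable => i.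
  by apply: filterS (open_nbhs_nbhs (conj oU Ux)) => y; exact: (df i).1.
by have [_ [Dfi _]] := df i; exact: Dfi.
Qed.

End Ck_calculus.

Lemma chain_rule (R : realType) m n p (f : 'rV[R]_n -> 'rV[R]_p)
    (g : 'rV[R]_m -> 'rV[R]_n) (x v : 'rV[R]_m) :
  differentiable g x -> differentiable f (g x) ->
  'D_v (f \o g) x = \sum_j ('D_v g x) 0 j *: 'D_(delta_mx 0 j) f (g x).
Proof.
move=> dg df; rewrite deriveE; last exact: differentiable_comp.
rewrite diff_comp//= -(deriveE v dg).
set w := 'D_v g x; rewrite [in LHS](row_sum_delta w).
rewrite (linear_sum ('d f (g x))).
by apply: eq_bigr => j _; rewrite linearZ/= (deriveE _ df).
Qed.

(** By induction on the order: a partial derivative of [f \o g] is a sum of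
    products of partial derivatives of [g] and of composites of partial
    derivatives of [f] with [g]. *)
Lemma Ck_on_comp (R : realType) m n p k (V : set 'rV[R]_m) (U : set 'rV[R]_n)
    (f : 'rV[R]_n -> 'rV[R]_p) (g : 'rV[R]_m -> 'rV[R]_n) :
  open V -> open U -> (forall x, V x -> U (g x)) ->
  Ck_on k V g -> Ck_on k U f -> Ck_on k V (f \o g).
Proof.
move=> oV oU VU; elim: k p f => [|k IH] p f Cg Cf.
  split; last exact: I.
  move=> x Vx; apply: continuous_comp; first exact: Cg.1.
  by apply: Cf.1; exact: VU.
have dg x : V x -> differentiable g x.
  exact: C1_on_differentiable oV (Ck_on_le (ltn0Sn k) Cg).
have df x : V x -> differentiable f (g x).
  by move=> /VU; exact: C1_on_differentiable oU (Ck_on_le (ltn0Sn k) Cf).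
split=> [x Vx|i].
  apply: continuous_comp; first exact: Cg.1.
  by apply: Cf.1; exact: VU.
split=> [x Vx|].
  by apply/diff_derivable/differentiable_comp; [exact: dg|exact: df].
apply: (@Ck_on_eq _ _ _ _ _ (fun x => \sum_j
    ('D_(delta_mx 0 i) g x) 0 j *: ((fun y => 'D_(delta_mx 0 j) f y) \o g) x)).
- by [].
- by move=> x Vx; rewrite chain_rule//; [exact: dg|exact: df].
- apply: Ck_on_sum => // j; apply: Ck_on_coord_scale => //.
    by have [] := Cg.2 i.
  by apply: IH; [exact: Ck_onW|have [] := Cf.2 j].
Qed.

(** * Measurability of Caratheodory compositions *)

Section borel_measurability.
Variable R : realType.

Lemma borel_measurableP (T : topologicalType) (f : Omega R -> T) :
  (forall O, open O -> measurable (f @^-1` O)) -> borel_measurable f.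
Proof.
move=> fO; apply: smallest_sub => //; split.
- by rewrite /= preimage_set0; exact: measurable0.
- move=> A mA; rewrite /= setTD preimage_setC; exact: measurableC.
- by move=> F mF; rewrite /= preimage_bigcup; exact: bigcupT_measurable.
Qed.

Lemma borel_measurable_open (T : topologicalType) (f : Omega R -> T) O :
  borel_measurable f -> open O -> measurable (f @^-1` O).
Proof. by move=> mf oO; apply: mf; exact: sub_sigma_algebra. Qed.

Lemma borel_measurable_cst (T : topologicalType) (c : T) :
  borel_measurable (fun _ : Omega R => c).
Proof.
apply: borel_measurableP => O _; rewrite preimage_cst.
by case: ifP => _; [exact: measurableT|exact: measurable0].
Qed.

Lemma borel_measurable_comp (T : topologicalType) (f : Omega R -> T)
    (Phi : Omega R -> Omega R) :
  borel_measurable f -> measurable_fun setT Phi -> borel_measurable (f \o Phi).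
Proof.
move=> mf mPhi B sB; rewrite comp_preimage -[X in measurable X]setTI.
by apply: mPhi => //; exact: mf.
Qed.

(** The weak form of metrizability under which pointwise limits of measurable
    maps are measurable. *)
Definition closed_exhaustible (T : topologicalType) := forall O : set T,
  open O -> exists V : nat -> set T,
    [/\ forall j, open (V j), forall j, closure (V j) `<=` O
      & O `<=` \bigcup_j V j].

(** Take the interior of the set of points whose ball of radius [1 / j.+1] lies
    in [O]. *)
Lemma closed_exhaustible_metric (T : pseudoMetricType R) :
  closed_exhaustible T.
Proof.
move=> O oO; pose B j := [set x : T | ball x j.+1%:R^-1 `<=` O].
exists (fun j => (B j)°); split=> [j|j x clx|x Ox].
- exact: open_interior.
- have [y [/interior_subset By xy]] : (B j)° `&` ball x j.+1%:R^-1 !=set0.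
    by apply: clx; exact: nbhsx_ballx.
  by apply: By; exact: ball_sym.
have /nbhs_ballP[e /= e0 xe] : nbhs x O by exact: open_nbhs_nbhs.
have e20 : 0 < e / 2 by rewrite divr_gt0.
exists (Num.truncn (e / 2)^-1) => //.
apply/nbhs_ballP; exists (e / 2) => //= y xy z yz; apply: xe.
rewrite (splitr e); apply: ball_triangle xy _; apply: le_ball yz.
by rewrite invf_ple ?posrE// ltW// truncnS_gt.
Qed.

(** By regularity the basic open sets with closure in [O] still cover [O]. *)
Lemma closed_exhaustible_regular (T : topologicalType) :
  regular_space T -> @second_countable T -> closed_exhaustible T.
Proof.
move=> regT [B cB [Bo Bb]] O oO.
have [f fB] : exists f : nat -> set T, B `<=` range f.
  have [->|/set0P B0] := eqVneq B set0; first by exists (fun=> set0).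
  have /pfcard_geP[B_eq|[f]] := cB; first by move: B0; rewrite B_eq => -[].
  by exists f => U BU; have [n _ fn] := @surj _ _ _ _ f U BU; exists n.
pose V j := if `[< B (f j) /\ closure (f j) `<=` O >] then f j else set0.
exists V; split=> [j|j|x Ox].
- by rewrite /V; case: asboolP => [[/Bo]//|_]; exact: open0.
- by rewrite /V; case: asboolP => [[]//|_]; rewrite closure0.
have [W Wx WO] := regT x O (open_nbhs_nbhs (conj oO Ox)).
have [U [BU Ux] UW] := Bb x W Wx.
have [j _ fj] := fB _ BU; exists j => //; rewrite /V asboolT fj//.
by split=> //; apply: subset_trans WO; exact: closureS.
Qed.

(** The limit is in [O] if and only if, for some [j], the sequence is eventually
    in [V j]: one direction because [V j] is open, the other because its closure
    lies in [O]. *)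
Lemma borel_measurable_lim (T : topologicalType) (F : nat -> Omega R -> T)
    (f : Omega R -> T) : closed_exhaustible T ->
  (forall k, borel_measurable (F k)) ->
  (forall w, F k w @[k --> \oo] --> f w) -> borel_measurable f.
Proof.
move=> exT mF Ff; apply: borel_measurableP => O /exT[V [oV clV OV]].
have -> : f @^-1` O =
    \bigcup_j \bigcup_N \bigcap_(k in [set k | (N <= k)%N]) (F k @^-1` V j).
  apply/seteqP; split=> [w /OV[j _ Vj]|w [j _ [N _ FV]]].
    have /Ff[N _ NF] : nbhs (f w) (V j) by exact: open_nbhs_nbhs.
    by exists j => //; exists N.
  apply: (clV j) => A /Ff[N' _ N'A].
  exists (F (maxn N N') w); split; first by apply: FV => /=; rewrite leq_maxl.
  by apply: N'A => /=; rewrite leq_maxr.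
apply: bigcupT_measurable => j; apply: bigcupT_measurable => N.
apply: bigcap_measurable => [|k _]; first by exists N => /=.
by apply: borel_measurable_open.
Qed.

(** Rounding down to the lattice of mesh [1 / k.+1]: it takes countably many
    values and moves points by at most the mesh. *)
Definition grid n k (x : 'rV[R]_n) : 'rV[R]_n :=
  \row_i ((Num.floor (x 0 i * k.+1%:R))%:~R / k.+1%:R).

Lemma grid_cvg n (x : 'rV[R]_n) : grid k x @[k --> \oo] --> x.
Proof.
apply/cvgrPdist_le => e e0; near=> k; apply: norm_le_coord => [|i].
  exact: ltW.
have k0 : 0 < k.+1%:R :> R by [].
have -> : (x - grid k x) 0 i =
    (x 0 i * k.+1%:R - (Num.floor (x 0 i * k.+1%:R))%:~R) / k.+1%:R.
  by rewrite !mxE mulrBl mulfK ?gt_eqF.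
have /andP[fl fg] := floor_itv (x 0 i * k.+1%:R).
rewrite normrM normfV (gtr0_norm k0) ler_pdivrMr// ger0_norm ?subr_ge0//.
apply: (@le_trans _ _ 1).
  by rewrite lerBlDr addrC -(intrD _ _ 1) ltW.
rewrite -ler_pdivrMl// mulr1; near: k; exists (Num.truncn e^-1) => // k /= ek.
by rewrite ltW// (lt_le_trans (truncnS_gt _))// ler_nat.
Unshelve. all: by end_near. Qed.

(** The fibers of the rounding are products of half-open intervals, that is
    finite intersections of differences of open half-spaces. *)
Lemma measurable_grid_fiber n k (G : Omega R -> 'rV[R]_n)
    (z : {ffun 'I_n -> int}) : borel_measurable G ->
  measurable (G @^-1` [set x | forall i, Num.floor (x 0 i * k.+1%:R) = z i]).
Proof.
move=> mG.
have coordM i : continuous (fun x : 'rV[R]_n => x 0 i * k.+1%:R).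
  by move=> x; apply: cvgMr_tmp; [exact: nbhs_filter|exact: coord_continuous].
have mlt i (a : R) : measurable [set w | G w 0 i * k.+1%:R < a].
  apply: (@borel_measurable_open _ G [set x | x 0 i * k.+1%:R < a]) => //.
  apply: (@open_comp _ _ _ [set y | y < a]); last exact: open_lt.
  by move=> x _; exact: coordM.
rewrite (_ : _ @^-1` _ = \bigcap_(i in [set: 'I_n])
    ([set w | G w 0 i * k.+1%:R < (z i + 1)%:~R] `\`
     [set w | G w 0 i * k.+1%:R < (z i)%:~R])).
  apply: fin_bigcap_measurable => // i _; exact: measurableD.
apply/seteqP; split=> w /= Gw i.
  move=> _; have /eqP := Gw i; rewrite floor_eq => /andP[l r]; split=> //=.
  by apply/negP; rewrite -leNgt.
have [//|r /negP] := Gw i; rewrite -leNgt => l.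
by apply/eqP; rewrite floor_eq l.
Qed.

(** With [G] rounded to a lattice, the preimage of an open set splits over the
    countably many lattice points, and on each piece the first argument of [p]
    is constant; the rounding converges to [G], and [p] is continuous in its
    first argument. *)
Lemma caratheodory_comp (T : topologicalType) n (p : OmegaN R n -> T)
    (G : Omega R -> 'rV[R]_n) (Phi : Omega R -> Omega R) :
  closed_exhaustible T ->
  (forall w, continuous (fun t => p (t, w))) ->
  (forall t, borel_measurable (fun w => p (t, w))) ->
  borel_measurable G -> measurable_fun setT Phi ->
  borel_measurable (fun w => p (G w, Phi w)).
Proof.
move=> exT pc pm mG mPhi.
apply: (@borel_measurable_lim _ (fun k w => p (grid k (G w), Phi w))) => //.
  move=> k; apply: borel_measurableP => O oO.
  pose pt (z : {ffun 'I_n -> int}) : 'rV[R]_n := \row_i ((z i)%:~R / k.+1%:R).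
  rewrite (_ : _ @^-1` O = \bigcup_(z : {ffun 'I_n -> int})
    ((G @^-1` [set x | forall i, Num.floor (x 0 i * k.+1%:R) = z i]) `&`
     ((fun w => p (pt z, w)) \o Phi) @^-1` O)).
    apply: countable_bigcupT_measurable; first exact: countableP.
    move=> z; apply: measurableI; first exact: measurable_grid_fiber.
    apply: borel_measurable_open => //.
    by apply: borel_measurable_comp => //; exact: pm.
  have gridE w (z : {ffun 'I_n -> int}) :
      (forall i, Num.floor (G w 0 i * k.+1%:R) = z i) -> grid k (G w) = pt z.
    by move=> Gz; apply/rowP => i; rewrite !mxE Gz.
  apply/seteqP; split=> [w Ow|w [z _ [/= /gridE Gz]]].
    exists [ffun i => Num.floor (G w 0 i * k.+1%:R)] => //.
    have Gz i : Num.floor (G w 0 i * k.+1%:R) =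
        [ffun i => Num.floor (G w 0 i * k.+1%:R)] i by rewrite ffunE.
    by split=> //=; rewrite -(gridE _ _ Gz).
  by rewrite -Gz.
move=> w.
exact: (@cvg_comp _ _ _ (fun k => grid k (G w)) (fun t => p (t, Phi w)) _ _ _
  (@grid_cvg _ (G w)) (pc (Phi w) (G w))).
Qed.

End borel_measurability.

(** * Morphisms of the site *)

Section site.
Variable R : realType.

Lemma smooth_continuous m n (g : 'rV[R]_m -> 'rV[R]_n) :
  smooth g -> continuous g.
Proof. by move=> /(_ 0%N) [gc _] x; exact: gc. Qed.

Lemma smooth_cst m n (c : 'rV[R]_n) : smooth (fun _ : 'rV[R]_m => c).
Proof. by move=> k; exact: Ck_on_cst. Qed.

Lemma smooth_id m : smooth (id : 'rV[R]_m -> 'rV[R]_m).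
Proof. by move=> k; exact: Ck_on_id. Qed.

Lemma smooth_on_comp m n p (U : set 'rV[R]_n)
    (f : 'rV[R]_n -> 'rV[R]_p) (g : 'rV[R]_m -> 'rV[R]_n) :
  open U -> smooth g -> smooth_on U f -> smooth_on (g @^-1` U) (f \o g).
Proof.
move=> oU sg sf k; apply: (@Ck_on_comp _ _ _ _ _ _ U) => //.
  by apply: open_comp => // x _; exact: smooth_continuous.
by apply: Ck_on_subset (sg k).
Qed.

Lemma smooth_comp m n p (f : 'rV[R]_n -> 'rV[R]_p)
    (g : 'rV[R]_m -> 'rV[R]_n) : smooth f -> smooth g -> smooth (f \o g).
Proof.
move=> sf sg; rewrite /smooth -(preimage_setT g).
by apply: smooth_on_comp => //; exact: openT.
Qed.

(** The common shape of the plots of Euclidean spaces, where [A] is smoothness,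
    and of manifolds, where [A] is smoothness in charts. *)
Definition fiberwise_plots (T : topologicalType)
    (A : forall n, set ('rV[R]_n -> T)) : plot_family R T :=
  fun n => [set p | (forall w, A n (fun t => p (t, w))) /\
                    (forall t, borel_measurable (fun w => p (t, w)))].

(** The one place where calculus, through the closure of [A] under smooth
    reparametrizations, and measure theory, through [caratheodory_comp], meet. *)
Lemma fiberwise_plots_comp (T : topologicalType)
    (A : forall n, set ('rV[R]_n -> T)) m n (p : OmegaN R n -> T)
    (g : OmegaN R m -> 'rV[R]_n) (Phi : Omega R -> Omega R) :
  closed_exhaustible T -> (forall k c, A k c -> continuous c) ->
  (forall c f, A n c -> smooth f -> A m (c \o f)) ->
  fiberwise_plots A p -> mixed_smooth g -> measurable_fun setT Phi ->
  fiberwise_plots A (fun x => p (g x, Phi x.2)).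
Proof.
move=> exT Ac Acomp [pA pm] [gs gm] mPhi; split=> [w|t].
  exact: (Acomp _ _ (pA (Phi w)) (gs w)).
apply: (@caratheodory_comp _ _ _ p (fun w => g (t, w)) Phi) => // w.
exact: Ac (pA w).
Qed.

Lemma mixed_smooth_comp l m n (f : OmegaN R n -> 'rV[R]_l)
    (g : OmegaN R m -> 'rV[R]_n) (Phi : Omega R -> Omega R) :
  mixed_smooth f -> mixed_smooth g -> measurable_fun setT Phi ->
  mixed_smooth (fun x => f (g x, Phi x.2)).
Proof.
move=> sf sg mPhi.
apply: (@fiberwise_plots_comp _ (fun n => @smooth R n l) _ _ f) => //.
- exact: (@closed_exhaustible_metric R 'rV[R]_l).
- by move=> k c; exact: smooth_continuous.
- by move=> c h; exact: smooth_comp.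
Qed.

Lemma site_hom_comp l m n (k : OmegaN R n -> OmegaN R l)
    (h : OmegaN R m -> OmegaN R n) :
  site_hom k -> site_hom h -> site_hom (k \o h).
Proof.
move=> [f [Psi [sf mPsi ->]]] [g [Phi [sg mPhi ->]]].
exists (fun x => f (g x, Phi x.2)), (Psi \o Phi); split=> //.
  exact: (mixed_smooth_comp sf sg mPhi).
exact: measurableT_comp.
Qed.

Lemma mixed_smooth_cst_sample m n (g : 'rV[R]_m -> 'rV[R]_n) :
  smooth g -> mixed_smooth (fun x : OmegaN R m => g x.1).
Proof. by move=> sg; split=> // t; exact: (borel_measurable_cst (g t)). Qed.

Lemma site_hom_reparam m n (g : 'rV[R]_m -> 'rV[R]_n) :
  smooth g -> site_hom (fun x : OmegaN R m => (g x.1, x.2)).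
Proof.
move=> sg; exists (fun x => g x.1), id; split=> //.
exact: mixed_smooth_cst_sample.
Qed.

Lemma site_hom_id n : site_hom (id : OmegaN R n -> OmegaN R n).
Proof.
rewrite (_ : id = fun x : OmegaN R n => (x.1, x.2)).
  by apply: (@site_hom_reparam _ _ id); exact: smooth_id.
by apply/funext => -[].
Qed.

Lemma site_hom_freeze n (w : Omega R) :
  site_hom (fun x : OmegaN R n => (x.1, w)).
Proof.
exists fst, (fun=> w); split=> //.
by apply: (@mixed_smooth_cst_sample _ _ id); exact: smooth_id.
Qed.

Lemma site_hom_section m n (t : 'rV[R]_n) :
  site_hom (fun x : OmegaN R m => (t, x.2)).
Proof. by apply: (@site_hom_reparam _ _ (fun=> t)); exact: smooth_cst. Qed.

End site.

(** * The maximal extension *)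

Section hat.
Variable R : realType.

Lemma plots_sub_hat (T : Type) (P : plot_family R T) n p :
  is_sample_smooth_space P -> P n p -> hat_plots P p.
Proof.
move=> [_ Pcomp] Pp; split=> [w|h hh]; last exact: Pcomp.
exact: (Pcomp _ _ _ _ Pp (@site_hom_freeze R n w)).
Qed.

(** The slice of [p \o h] at [w] involves the slice of [p] at [Phi w] only, so
    it is a parameter family reparametrized by the smooth map [g (-, w)]. *)
Lemma hat_plots_space (T : Type) (P : plot_family R T) :
  is_sample_smooth_space P -> is_sample_smooth_space (hat_plots P).
Proof.
move=> [Pcst Pcomp]; split=> [n x|m n p h [pP pR] hh].
  by split=> [w|h _]; exact: Pcst.
split=> [w|k hk]; last exact: (pR _ (site_hom_comp hh hk)).
have [g [Phi [[gs gm] mPhi ->]]] := hh.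
exact: (Pcomp _ _ _ _ (pP (Phi w)) (site_hom_reparam (gs w))).
Qed.

(** The maximal extension has the random variables and the parameter families
    of the space it extends, and is determined by them. *)
Lemma hat_plots_idem (T : Type) (P : plot_family R T) :
  is_sample_smooth_space P -> hat_plots (hat_plots P) = hat_plots P.
Proof.
move=> sP; apply: functional_extensionality_dep => n.
apply/seteqP; split=> p; last first.
  by apply: plots_sub_hat; exact: hat_plots_space.
move=> [pP pR]; split=> [w|h hh].
  by have [/(_ w)] := pP w.
by have [_ /(_ id (@site_hom_id R 0))] := pR h hh.
Qed.

Lemma hat_plots_functorial (S T : Type) (P : plot_family R S)
    (Q : plot_family R T) (f : S -> T) :
  sample_smooth P Q f -> sample_smooth (hat_plots P) (hat_plots Q) f.
Proof.
move=> fPQ n p [pP pR]; split=> [w|h hh]; first exact: fPQ (pP w).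
exact: fPQ (pR h hh).
Qed.

(** The other inclusion is automatic. *)
Lemma is_presented_spaceI (T : Type) (P : plot_family R T) :
  is_sample_smooth_space P ->
  (forall n (p : OmegaN R n -> T), hat_plots P p -> P n p) ->
  is_presented_space P.
Proof.
move=> sP hatP; exists sP; apply: functional_extensionality_dep => n.
by apply/seteqP; split=> p; [exact: plots_sub_hat|exact: hatP].
Qed.

Lemma SSS_eq (T : Type) (P Q : plot_family R T)
    (sP : is_sample_smooth_space P) (sQ : is_sample_smooth_space Q) :
  P = Q -> MkSSS sP = MkSSS sQ.
Proof. by move=> PQ; subst Q; congr MkSSS; exact: Prop_irrelevance. Qed.

End hat.

(** * Presented spaces *)

Section examples.
Variable R : realType.

(** Both conditions on a plot are already visible on what the maximal extension
    tests: the slices at fixed [w], and the random variables obtained by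
    composing with the sections at fixed [t]. *)
Lemma fiberwise_plots_presented (T : topologicalType)
    (A : forall n, set ('rV[R]_n -> T)) :
  closed_exhaustible T -> (forall n c, A n c -> continuous c) ->
  (forall n x, A n (fun=> x)) ->
  (forall m n c (g : 'rV[R]_m -> 'rV[R]_n),
     A n c -> smooth g -> A m (c \o g)) ->
  is_presented_space (fiberwise_plots A).
Proof.
move=> exT Ac Acst Acomp; apply: is_presented_spaceI.
  split=> [n x|m n p h pP [g [Phi [sg mPhi ->]]]].
    by split=> [w|t]; [exact: Acst|exact: (borel_measurable_cst x)].
  exact: (fiberwise_plots_comp exT Ac (fun c f => @Acomp m n c f) pP sg mPhi).
move=> n p [pP pR]; split=> [w|t].
  by have [/(_ w)] := pP w.
by have [_ /(_ 0)] := pR _ (@site_hom_section R 0 n t).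
Qed.

Lemma euclidean_presented k : is_presented_space (euclidean_plots R k).
Proof.
apply: (@fiberwise_plots_presented _ (fun n => @smooth R n k)).
- exact: (@closed_exhaustible_metric R 'rV[R]_k).
- by move=> n c; exact: smooth_continuous.
- by move=> n x; exact: smooth_cst.
- by move=> m n c g; exact: smooth_comp.
Qed.

(** The image of a small closed ball under the inverse chart. *)
Lemma chart_dom_compact_nbhs (M : topologicalType) d (c : chart R M d) x :
  chart_dom c x -> exists2 K, compact K & nbhs x K.
Proof.
move=> cx.
have img_x : (chart_map c @` chart_dom c) (chart_map c x) by exists x.
have /nbhs_normP[e /= e0 eK] :=
  open_nbhs_nbhs (conj (@chart_img_open _ _ _ c) img_x).
have e20 : 0 < e / 2 by rewrite divr_gt0.
pose K := [set y : 'rV[R]_d | `|chart_map c x - y| <= e / 2].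
have K_img : K `<=` chart_map c @` chart_dom c.
  move=> y Ky; apply: eK => /=; apply: le_lt_trans Ky _.
  by rewrite ltr_pdivrMr// ltr_pMr// ltr1n.
exists (chart_inv c @` K).
  apply: continuous_compact.
    by apply: continuous_subspaceW (@chart_inv_continuous _ _ _ c).
  rewrite (_ : K = closed_ball (chart_map c x) (e / 2)); last first.
    by rewrite closed_ballE.
  apply: bounded_closed_compact; last exact: closed_ball_closed.
  rewrite closed_ballE//; exists (`|chart_map c x| + e / 2).
  split=> [|r er y /= Ky]; first exact: num_real.
  rewrite -[y](subKr (chart_map c x)) (le_trans (ler_normB _ _))//.
  by rewrite (le_trans _ (ltW er))// lerD2l.
have := @chart_map_continuous _ _ _ c.
rewrite continuous_open_subspace; last exact: chart_dom_open.
move=> /(continuous_inP _ (@chart_dom_open _ _ _ c)) map_cont.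
rewrite nbhsE.
exists (chart_dom c `&` chart_map c @^-1` ball (chart_map c x) (e / 2)).
  split; last by split=> //; exact: ballxx.
  by apply: map_cont; exact: ball_open.
move=> z [cz zB]; exists (chart_map c z); last first.
  by apply: chart_mapK; exact: mem_set.
by move: zB; rewrite /= -ball_normE /= => /ltW.
Qed.

Lemma manifold_exhaustible (M : manifold R) : closed_exhaustible M.
Proof.
apply: closed_exhaustible_regular; last exact: mf_second_countable.
move=> x; have [c _ cx] := mf_atlas_cover x.
have [K cK xK] := chart_dom_compact_nbhs cx.
exact: compact_regular (@mf_hausdorff R M) cK xK.
Qed.

Lemma manifold_presented (M : manifold R) :
  is_presented_space (manifold_plots M).
Proof.
apply: (@fiberwise_plots_presented _ (fun n => @smooth_into R n M)).
- exact: manifold_exhaustible.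
- by move=> n c [].
- move=> n x; split=> [|phi _ k]; first by move=> t; exact: cst_continuous.
  exact: Ck_on_cst.
- move=> m n c g [cc cs] sg; split=> [t|phi phiM].
    by apply: continuous_comp; [exact: smooth_continuous|exact: cc].
  apply: (@smooth_on_comp _ _ _ _ (c @^-1` chart_dom phi)) (cs _ phiM) => //.
  by apply: open_comp => [t _|]; [exact: cc|exact: chart_dom_open].
Qed.

(** A slice of [p] is constant in [t], so [p] agrees with its restriction to
    [t = 0]; that restriction is a random variable. *)
Lemma flat_presented (S : quasi_universal_space R) :
  is_presented_space (flat_plots S).
Proof.
apply: is_presented_spaceI.
  split=> [n x|m n p h [X rX ->] [g [Phi [_ mPhi ->]]]].
    by exists (fun=> x) => //; exact: qus_rv_const.
  by exists (X \o Phi) => //; exact: qus_rv_comp.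
move=> n p [pP pR].
have [X rX pX] := pR _ (@site_hom_section R 0 n 0).
exists X => //; apply/funext => -[t w].
have [Y _ pY] := pP w.
have := congr1 (fun f => f (0, w)) pX; rewrite /= => <-.
have /= -> := congr1 (fun f => f (t, w)) pY.
by have /= -> := congr1 (fun f => f (0, w)) pY.
Qed.

Lemma sharp_presented (S : quasi_universal_space R) :
  is_presented_space (sharp_plots S).
Proof.
apply: is_presented_spaceI.
  split=> [n x h _|m n p h pP hh k hk]; first exact: qus_rv_const.
  exact: (pP _ (site_hom_comp hh hk)).
by move=> n p [_ pR] h hh; exact: (pR h hh id (@site_hom_id R 0)).
Qed.

Lemma prod_presented (I : Type) (X : I -> SSS R) :
  (forall i, presented (X i)) ->
  is_presented_space (prod_plots (fun i => plots (X i))).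
Proof.
move=> pX; apply: is_presented_spaceI.
  split=> [n x i|m n p h pP hh i]; first exact: (sssP (X i)).1.
  exact: (sssP (X i)).2 (pP i) hh.
move=> n p [pP pR] i; rewrite pX; split=> [w|h hh]; first exact: pP w i.
exact: pR h hh i.
Qed.

End examples.

(** * The reflection *)

Theorem proposition4p31 (R : realType) :
  exists (hat_obj : forall X : SSS R,
            is_sample_smooth_space (hat_plots (plots X)))
         (hat_hom : forall (X Y : SSS R) (f : X -> Y),
            sample_smooth (plots X) (plots Y) f ->
            sample_smooth (hat_plots (plots X)) (hat_plots (plots Y)) f),
  let hat := hat_functor hat_obj hat_hom in
  [/\ (forall X : SSS R, hat (hat X) = hat X),
      (exists eta : nat_trans (id_functor (SSS_cat R)) hat,
         (forall (X : SSS R) (x : X), sss_fun (eta X) x = x) /\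
         (exists (hat_presented : forall X : SSS R, presented (hat X))
                 (A : adjunction (corestriction (@presented R) hat hat_presented)
                                 (inclusion (@presented R))),
            forall X : SSS R, unit A X = eta X)),
      (forall k : nat, is_presented_space (euclidean_plots R k)) /\
      (forall M : manifold R, is_presented_space (manifold_plots M)) /\
      (forall S : quasi_universal_space R,
        is_presented_space (flat_plots S) /\ is_presented_space (sharp_plots S))
    & forall (I : Type) (X : I -> SSS R), (forall i, presented (X i)) ->
        is_presented_space (prod_plots (fun i => plots (X i)))].
Proof.
pose hat_obj (X : SSS R) := hat_plots_space (sssP X).
pose hat_hom (X Y : SSS R) (f : X -> Y)
    (fP : sample_smooth (plots X) (plots Y) f) := hat_plots_functorial fP.
exists hat_obj, hat_hom; set hat := hat_functor hat_obj hat_hom; split.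
- by move=> X; apply: SSS_eq; exact: hat_plots_idem (sssP X).
- pose eta_hom (X : SSS R) : sss_hom X (hat X) :=
    @SSSHom R X (hat X) (fun x => x) (fun n p Pp => plots_sub_hat (sssP X) Pp).
  pose eta : nat_trans (id_functor (SSS_cat R)) hat :=
    @NatTrans _ _ (id_functor (SSS_cat R)) hat eta_hom
      (fun X Y f => @sss_hom_eq R X (hat Y)
        (sss_cmp (eta_hom Y) f)
        (sss_cmp (@Defs.fmap _ _ hat X Y f) (eta_hom X)) erefl).
  exists eta; split=> //.
  have hatP (X : SSS R) : presented (hat X).
    by rewrite /presented/= hat_plots_idem//; exact: sssP.
  exists hatP.
  pose L := corestriction (@presented R) hat hatP.
  pose U := inclusion (@presented R).
  pose eta' : nat_trans (id_functor (SSS_cat R)) (comp_functor U L) :=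
    @NatTrans _ _ (id_functor (SSS_cat R)) (comp_functor U L) eta_hom
      (naturality eta).
  (* the counit is the identity map, a morphism since [Y] is presented *)
  have epsP (Y : full_subcategory (@presented R)) :
      sample_smooth (plots (hat (sval Y))) (plots (sval Y)) (fun x => x).
    by move=> n p; rewrite [in X in _ -> X](svalP Y).
  pose eps_hom (Y : full_subcategory (@presented R)) :
      Defs.hom (comp_functor L U Y) (id_functor _ Y) :=
    @SSSHom R (hat (sval Y)) (sval Y) (fun x => x) (epsP Y).
  pose eps : nat_trans (comp_functor L U) (id_functor _) :=
    @NatTrans _ _ (comp_functor L U) (id_functor _) eps_hom
      (fun X Y f => @sss_hom_eq R (hat (sval X)) (sval Y)
        (Defs.cmp (eps_hom Y) (Defs.fmap (comp_functor L U) f))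
        (Defs.cmp f (eps_hom X)) erefl).
  unshelve eexists (@Adjunction _ _ L U eta' eps _ _).
  + by move=> X; apply: sss_hom_eq.
  + by move=> Y; apply: sss_hom_eq.
  + by [].
- split; first exact: euclidean_presented.
  split; first exact: manifold_presented.
  by move=> S; split; [exact: flat_presented|exact: sharp_presented].
- exact: prod_presented.
Qed.
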